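(* Let $K$ be a (polygonally) cellulated $2$-sphere embedded in $\mathbb{R}^3$ with $v$ vertices, and let $K'$ be the punctured cellulated $2$-sphere obtained by removing a face from $K$. Then the number $\mu$ of Pfaffian orientations on $K'$ is $$\mu = 2^{\,v-1}.$$
   Context: A (polygonally) cellulated surface is a surface with a polygonal cell decomposition; its $2$-cells are called faces, its $1$-cells edges and its $0$-cells vertices, and $\mathcal{F}(K)$, $\mathcal{E}(K)$, $\mathcal{V}(K)$ denote the sets of faces, edges and vertices of $K$. We write $e\subseteq f$ if the edge $e$ is contained in the face $f$ (i.e. is an edge of $f$). The cellulated surface $K$ has the following properties: (a) each edge of $K$ is contained in exactly two faces of $K$; (b) any two faces $f_0,f_n$ are joined by a sequence $f_0,e_0,f_1,\dots,e_{n-1},f_n$ of faces and edges with $f_i\supseteq e_i\subseteq f_{i+1}$ for all $i$. Each face is given the orientation determined by the right-hand rule along its outward normal vector; thus the two faces containing a given edge induce opposite orientations on that edge. The punctured cellulated surface $K'$ is obtained from $K$ by removing one face (the $2$-cell only; all edges and vertices are kept), so $\mathcal{F}(K')=\mathcal{F}(K)\setminus\{f_0\}$ for some $f_0 \in \mathcal{F}(K)$, $\mathcal{E}(K')=\mathcal{E}(K)$ and $\mathcal{V}(K')=\mathcal{V}(K)$. A Pfaffian orientation on $K'$ is an assignment of an orientation (direction) to each edge of $K'$ such that for every face $f$ of $K'$, the number of edges $e$ of $f$ whose orientation is opposite to the orientation induced by $f$ on $e$ is odd. *)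

(* Defs.v *)
(* MathComp / MathComp-Analysis *)
From HB Require Import structures.
From mathcomp Require Import all_boot all_order all_algebra.
From mathcomp Require Import all_classical all_reals all_analysis.

Set Implicit Arguments.
Unset Strict Implicit.
Unset Printing Implicit Defensive.

Import Order.TTheory GRing.Theory Num.Theory.
Import numFieldNormedType.Exports.

Local Open Scope classical_set_scope.
Local Open Scope ring_scope.

(* The topology of 'rV[R]_n is that of the sup norm; the round spheres and
   discs are cut out by the Euclidean norm. *)
Definition sqnorm (R : realType) (n : nat) (x : 'rV[R]_n) : R :=
  \sum_(i < n) x ord0 i ^+ 2.

Definition unit_sphere (R : realType) (n : nat) : set 'rV[R]_n.+1 :=
  [set x | sqnorm x = 1].

Definition closed_disc (R : realType) : set 'rV[R]_2 := [set x | sqnorm x <= 1].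

Definition open_disc (R : realType) : set 'rV[R]_2 := [set x | sqnorm x < 1].

Definition homeomorphic (R : realType) (m n : nat)
    (A : set 'rV[R]_m) (B : set 'rV[R]_n) : Prop :=
  exists (h : 'rV[R]_m -> 'rV[R]_n) (k : 'rV[R]_n -> 'rV[R]_m),
    [/\ {within A, continuous h}, {within B, continuous k},
        h @` A = B, k @` B = A & forall x, A x -> k (h x) = x].

Definition is_2sphere (R : realType) (S : set 'rV[R]_3) : Prop :=
  homeomorphic (@unit_sphere R 2) S.

(* The point of the unit circle reached, counterclockwise, after t turns. *)
Definition circle_pt (R : realType) (t : R) : 'rV[R]_2 :=
  \row_(i < 2) (if i == ord0 then cos (pi *+ 2 * t) else sin (pi *+ 2 * t)).

(* Cells, with their characteristic maps.  The parametrisation [epar e] fixes a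
   reference direction of the edge e.  [bdry f] lists the sides of the polygon f
   in the cyclic order given by the orientation of f; (e, true) is the edge e
   traversed in its reference direction and (e, false) the edge e traversed
   backwards.  [phi f] is a characteristic map of f, defined on the closed
   disc. *)
Record cells (R : realType) := Cells {
  vertex : finType;
  edge : finType;
  face : finType;
  vpt : vertex -> 'rV[R]_3;
  epar : edge -> R -> 'rV[R]_3;
  bdry : face -> seq (edge * bool);
  phi : face -> 'rV[R]_2 -> 'rV[R]_3
}.

Definition open_cell (R : realType) (K : cells R)
    (c : vertex K + edge K + face K) : set 'rV[R]_3 :=
  match c with
  | inl (inl v) => [set vpt v]
  | inl (inr e) => epar e @` `]0, 1[
  | inr f => phi f @` @open_disc R
  end.

Definition edge_of (R : realType) (K : cells R) (e : edge K) (f : face K) : bool :=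
  e \in [seq s.1 | s <- bdry f].

(* K is a finite polygonal cell decomposition of S.  By [side_par] the disc with
   its boundary circle divided into n equal arcs is the polygon with n sides,
   and its k-th side is mapped onto the k-th edge of [bdry f], preserving the
   parameter; every polygonal attaching map takes this form after
   reparametrising the disc.  Corners of one face may be identified, and
   polygons with one or two sides and loops are allowed. *)
Record is_decomposition (R : realType) (S : set 'rV[R]_3) (K : cells R) : Prop := {
  cells_cover : \bigcup_(c : vertex K + edge K + face K) open_cell c = S;
  cells_disjoint : trivIset setT (@open_cell R K);
  epar_cont : forall e : edge K, {within `[0, 1], continuous (epar e)};
  epar_inj : forall (e : edge K) (s t : R),
    0 < s < 1 -> 0 < t < 1 -> epar e s = epar e t -> s = t;
  epar_ends : forall e : edge K,
    range (@vpt R K) (epar e 0) /\ range (@vpt R K) (epar e 1);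
  phi_cont : forall f : face K, {within @closed_disc R, continuous (phi f)};
  phi_inj : forall (f : face K) (x y : 'rV[R]_2),
    open_disc x -> open_disc y -> phi f x = phi f y -> x = y;
  bdry_pos : forall f : face K, (0 < size (bdry f))%N;
  side_par : forall (f : face K) (k : nat) (e : edge K) (b : bool) (t : R),
    onth (bdry f) k = Some (e, b) -> 0 <= t <= 1 ->
    phi f (circle_pt ((k%:R + t) / (size (bdry f))%:R))
      = epar e (if b then t else 1 - t)
}.

(* The orientations of the faces are an arbitrary coherent choice
   ([opposite_orientations]); the one given by the right-hand rule along the
   outward normal is an instance.  [edges_once] says that a face does not run
   twice along the same edge, so that it induces one orientation on each of its
   edges. *)
Record is_cellulated_surface (R : realType) (S : set 'rV[R]_3) (K : cells R)
    : Prop := {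
  decomposition : is_decomposition S K;
  edges_once : forall f : face K, uniq [seq s.1 | s <- bdry f];
  two_faces : forall e : edge K, #|[set f : face K | edge_of e f]%SET| = 2%N;
  faces_joined : forall f g : face K,
    connect [rel f1 f2 | [exists e, edge_of e f1 && edge_of e f2]] f g;
  opposite_orientations :
    forall (e : edge K) (f g : face K) (b c : bool),
      f != g -> (e, b) \in bdry f -> (e, c) \in bdry g -> b != c
}.

(* Only the set of faces changes when K is punctured. *)
Definition punctured_faces (R : realType) (K : cells R) (f0 : face K)
    : {set face K} := [set~ f0]%SET.

(* An assignment o of orientations to the edges: o e is true when e gets its
   reference direction.  Hence (e, ~~ o e) \in bdry f says that e is an edge of f
   on which f induces the orientation opposite to the one assigned by o. *)
Definition pfaffian (R : realType) (K : cells R) (Fs : {set face K})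
    (o : {ffun edge K -> bool}) : bool :=
  [forall f in Fs, odd #|[set e : edge K | (e, ~~ o e) \in bdry f]%SET|].

(* Main.v *)
Require Import Defs.
From HB Require Import structures.
From mathcomp Require Import all_boot all_order all_algebra.
From mathcomp Require Import all_classical all_reals all_analysis.
From mathcomp Require Import ring lra zify.

Set Implicit Arguments.
Unset Strict Implicit.
Unset Printing Implicit Defensive.

Import Order.TTheory GRing.Theory Num.Theory.
Import numFieldNormedType.Exports.

Local Open Scope ring_scope.

(** Write V, E, F for the numbers of vertices, edges and faces of K.  There are
    two independent ingredients.

    Counting.  Modulo 2, being Pfaffian is an affine linear condition on the
    edge orientations, one equation per remaining face ([face_parityE]).  These
    F - 1 equations are independent: reversing the edges crossed by a path of
    adjacent faces from f to the removed face f0 changes the parity of f and of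
    no other remaining face ([delta_boundary]).  So all the right-hand sides
    have equally many solutions and mu = 2 ^ (E - (F - 1)) ([card_pfaffian]).

    Euler's formula V - E + F = 2, which turns the exponent into V - 1.  It is
    a dimension count in the rational cochain complex C0 -> C1 -> C2 of K
    ([Euler_formula]).  The image of C1 -> C2 is the hyperplane of
    total sum 0, by the same paths of faces and by the coherence of the face
    orientations.  That the kernel of C0 -> C1 is the line of constants and
    that the complex is exact at C1 is where the topology of the sphere enters.

    The topological input is elementary.  Let p be the centre of the open face
    f0.  The 1-skeleton avoids p, and the sphere minus p contracts to a point
    along images of great circles ([punctured_sphere_contraction]).

    Connectedness ([vertices_connected]): a function on the vertices that is
    invariant along edges extends to a continuous integer-valued function on S,
    which is constant along the track of each vertex under the contraction.

    Exactness ([cocycle_exact]): an integral cocycle c defines a continuous map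
    from S to the circle, which sends the vertices to 1, winds c e times along
    the edge e, and extends over each face as a cone since the total winding
    along the boundary of the face is 0 ([circle_valued_map]).  Composing with
    the contraction and adding up small angle differences along each track
    ([fine_subdivision], [turn]) lifts this map, over the 1-skeleton, to a
    continuous real function.  Along e the lift increases by exactly c e, so its
    values at the vertices form a potential of c. *)

(** * Cochains on the edges and their sums around faces *)

Section Cochains.
Context {R : realType} {S : set 'rV[R]_3} {K : cells R}.
Hypothesis hK : is_cellulated_surface S K.
Implicit Types (e : edge K) (f g : face K).

(** The cellular coboundary of [x], evaluated on [f]. *)
Definition face_sum (A : zmodType) (x : edge K -> A) f : A :=
  \sum_(s <- bdry f) (if s.2 then x s.1 else - x s.1).

Lemma face_sumB (A : zmodType) (x y : edge K -> A) f :
  face_sum (fun e => x e - y e) f = face_sum x f - face_sum y f.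
Proof.
rewrite /face_sum -sumrB; apply: eq_bigr => s _.
by case: s.2; rewrite // opprB opprK addrC.
Qed.

Lemma face_sum_morph (A B : zmodType) (h : {additive A -> B}) (x : edge K -> A) f :
  face_sum (fun e => h (x e)) f = h (face_sum x f).
Proof.
rewrite /face_sum raddf_sum; apply: eq_bigr => s _.
by case: s.2; rewrite // raddfN.
Qed.

Lemma face_sum_eq (A : zmodType) (x y : edge K -> A) f :
  x =1 y -> face_sum x f = face_sum y f.
Proof. by move=> xy; apply: eq_bigr => s _; rewrite xy. Qed.

Definition edge_delta (A : zmodType) (a : A) e0 e : A := if e == e0 then a else 0.

Lemma face_sum_delta0 (A : zmodType) (a : A) e0 f :
  ~~ edge_of e0 f -> face_sum (edge_delta a e0) f = 0.
Proof.
move=> e0f; rewrite /face_sum big_seq big1 // => s sf.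
rewrite /edge_delta; case: eqP => [se|]; last by rewrite oppr0 if_same.
by move: e0f; rewrite /edge_of -se map_f.
Qed.

Lemma face_sum_delta (A : zmodType) (a : A) e0 b f :
  (e0, b) \in bdry f -> face_sum (edge_delta a e0) f = if b then a else - a.
Proof.
move=> ef; rewrite /face_sum (big_rem _ ef) /= /edge_delta eqxx big_seq big1 ?addr0// => s.
move=> sf; case: eqP => [se|]; last by rewrite oppr0 if_same.
have := edges_once hK f.
rewrite (perm_uniq (perm_map fst (perm_to_rem ef))) /= => /andP[+ _].
by have := map_f fst sf; rewrite se => ->.
Qed.

Lemma edge_of_two e f g h :
  f != g -> edge_of e f -> edge_of e g -> edge_of e h -> (h == f) || (h == g).
Proof.
move=> fg ef eg eh.
have : [set f; g]%SET \subset [set f : face K | edge_of e f]%SET.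
  by apply/fintype.subsetP => i; rewrite !inE => /orP[]/eqP->.
have /subset_cardP sub : #|[set f; g]%SET| = #|[set f : face K | edge_of e f]%SET|.
  by rewrite (two_faces hK) cards2 fg.
by move=> /sub/(_ h); rewrite !inE eh => ->.
Qed.

Lemma edge_ofP e f : reflect (exists b, (e, b) \in bdry f) (edge_of e f).
Proof.
apply: (iffP mapP) => [[[e' b] ef /= ->]|[b ef]]; first by exists b.
by exists (e, b).
Qed.

(** Follow a path of adjacent faces from [f0] to [f].  At each crossing of an
    edge, a multiple of the cochain of that edge moves the nonzero value from
    one face to the next: the two faces see the edge with opposite signs. *)
Lemma delta_boundary (A : zmodType) (a : A) f0 f :
  exists x : edge K -> A, forall g,
    face_sum x g = (if g == f then a else 0) - (if g == f0 then a else 0).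
Proof.
have /connectP[p pth ->] := faces_joined hK f0 f.
elim/last_ind: p pth => [_|p f2 IHp] /=.
  by exists (fun=> 0) => g; rewrite subrr /face_sum big1 // => s _; rewrite oppr0 if_same.
rewrite rcons_path last_rcons => /andP[/IHp[x xE]].
set f1 := last _ _ in xE * => /existsP[e /andP[ef1 ef2]].
have [<-|f12] := eqVneq f1 f2; first by exists x.
have /edge_ofP[b bf1] := ef1; have /edge_ofP[c bf2] := ef2.
have bc := opposite_orientations hK f12 bf1 bf2.
exists (fun e' => x e' - edge_delta (if b then a else - a) e e') => g.
rewrite face_sumB xE.
have [gf1|gf1] := eqVneq g f1.
  rewrite gf1 (negPf f12) (face_sum_delta _ bf1) sub0r addrAC.
  by case: (b); rewrite ?opprK subrr sub0r.
have [gf2|gf2] := eqVneq g f2.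
  rewrite gf2 (face_sum_delta _ bf2) sub0r.
  by case: (b) (c) bc => [] []// _; rewrite ?opprK addrC.
rewrite face_sum_delta0 ?subr0//.
by apply/negP => eg; have := edge_of_two f12 ef1 ef2 eg; rewrite (negPf gf1) (negPf gf2).
Qed.

(** The two faces of an edge contribute opposite signs. *)
Lemma total_face_sum (A : zmodType) (x : edge K -> A) : \sum_f face_sum x f = 0.
Proof.
(* the contribution of the edge e to the sum around f *)
pose w e f := \sum_(s <- bdry f | s.1 == e) (if s.2 then x s.1 else - x s.1).
have -> : \sum_f face_sum x f = \sum_f \sum_e w e f.
  by apply: eq_bigr => f _; rewrite /face_sum (partition_big fst xpredT).
rewrite exchange_big big1 // => e _.
have [f [g [fg efg]]] :
    exists f, exists g, f != g /\ [set f : face K | edge_of e f]%SET = [set f; g]%SET.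
  by apply/cards2P; rewrite (two_faces hK).
have wE h b : (e, b) \in bdry h -> w e h = if b then x e else - x e.
  move=> eh; rewrite -(face_sum_delta (x e) eh) /face_sum /w big_mkcond.
  apply: eq_bigr => s _; rewrite /edge_delta; case: eqP => [->//|_].
  by rewrite oppr0 if_same.
have w0 h : ~~ edge_of e h -> w e h = 0.
  move=> eh; rewrite /w big_seq_cond big1 // => s /andP[sh /eqP se].
  by move: eh; rewrite /edge_of -se map_f.
have /edge_ofP[b ef] : edge_of e f by have /setP/(_ f) := efg; rewrite !inE eqxx.
have /edge_ofP[c eg] : edge_of e g by have /setP/(_ g) := efg; rewrite !inE eqxx orbT.
have bc := opposite_orientations hK fg ef eg.
rewrite (bigD1 f)//= (bigD1 g) 1?eq_sym//= big1 => [|h /andP[hf hg]]; last first.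
  by apply: w0; have /setP/(_ h) := efg; rewrite !inE (negPf hf) (negPf hg) => ->.
rewrite (wE _ _ ef) (wE _ _ eg) addr0.
by case: (b) (c) bc => [] []// _; rewrite ?subrr ?addNr.
Qed.

End Cochains.

(** * Counting Pfaffian orientations modulo two *)

Section Count.
Context {R : realType} {S : set 'rV[R]_3} {K : cells R}.
Hypothesis hK : is_cellulated_surface S K.
Implicit Types (e : edge K) (f g : face K).

Definition face_parity (o : edge K -> bool) f : bool :=
  odd #|[set e : edge K | (e, ~~ o e) \in bdry f]%SET|.

(** In the field [bool] of two elements the signs of [face_sum] disappear, and
    an orientation disagrees with the side [s] exactly when [o s.1 + s.2] is 1.
    So the parity is an affine function of [o] with linear part [face_sum]. *)
Lemma face_parityE (o : edge K -> bool) f :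
  face_parity o f = face_sum o f + \sum_(s <- bdry f) s.2.
Proof.
rewrite /face_sum -big_split /= /face_parity.
have -> : [set e : edge K | (e, ~~ o e) \in bdry f]%SET =
    [set e in [seq s.1 | s <- [seq s <- bdry f | s.2 != o s.1]]]%SET.
  apply/setP => e; rewrite !inE; apply/idP/mapP => [ef|[[e' b]]].
    by exists (e, ~~ o e); rewrite // mem_filter ef /= andbT; case: (o e).
  rewrite mem_filter /= => /andP[bo ef] ->.
  by move: ef bo; case: (b) (o e') => [] [].
rewrite cardsE (card_uniqP _); last first.
  have /subseq_uniq : subseq [seq s.1 | s <- [seq s <- bdry f | s.2 != o s.1]]
     [seq s.1 | s <- bdry f] by apply: map_subseq; exact: filter_subseq.
  by apply; exact: edges_once hK f.
rewrite size_map; elim: (bdry f) => [|s l IHl]; first by rewrite big_nil.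
rewrite big_cons -IHl /=.
by case: s => e [] /=; case: (o e); rewrite /= /GRing.add /=; case: odd.
Qed.

(** The map [Phi] recording the parities of the faces other than [f0] takes its
    values in a set with 2 ^ (F - 1) elements, and [delta_boundary] yields
    translations that exchange its fibres; the Pfaffian orientations are the
    fibre over the constant parity 1. *)
Lemma card_pfaffian f0 :
  (2 ^ #|edge K| = 2 ^ (#|face K| - 1) *
    #|[set o : {ffun edge K -> bool} | pfaffian (punctured_faces f0) o]%SET|)%N.
Proof.
set mu := #|_|.
pose Phi (o : {ffun edge K -> bool}) := [ffun f => (f != f0) && face_parity o f].
pose T := pffun_on false (predC1 f0) (@predT bool).
have TE b : (b \in T) = (b f0 == false).
  apply/pffun_onP/idP => [[/fintype.subsetP + _]|/eqP bf].
    by move=> /(_ f0); rewrite !inE eqxx; case: (b f0) => // /(_ isT).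
  split; last by [].
  by apply/fintype.subsetP => f; rewrite !inE; apply: contraNneq => ->; rewrite bf.
have cardT : #|T| = (2 ^ (#|face K| - 1))%N.
  by rewrite card_pffun_on card_bool cardC1 subn1.
have PhiT o : Phi o \in T by rewrite TE ffunE eqxx.
have -> : (2 ^ #|edge K| = #|{ffun edge K -> bool}|)%N by rewrite card_ffun card_bool.
rewrite -sum1_card (partition_big Phi (mem T)) => [|o _]; last exact: PhiT.
rewrite -cardT -sum_nat_const; apply: eq_bigr => b bT.
pose c := [ffun f => f != f0].
(* adding x carries the fibre over b to the fibre over c *)
have [x xE] : exists x : edge K -> bool, forall g, g != f0 ->
    face_sum x g = (b g (+) c g).
  have [y yE] := choice (fun f => @delta_boundary _ _ _ hK _ (b f (+) c f) f0 f).
  exists (fun e => \sum_f y f e) => g gf0.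
  transitivity (\sum_f face_sum (y f) g).
    rewrite /face_sum exchange_big; apply: eq_bigr => s _.
    by case: s.2; rewrite // sumrN.
  under eq_bigr do rewrite yE (negPf gf0) subr0.
  by rewrite (bigD1 g)//= eqxx big1 ?addr0// => f /negPf; rewrite eq_sym => ->.
pose tr (o : {ffun edge K -> bool}) := [ffun e => o e (+) x e].
have trK : involutive tr by move=> o; apply/ffunP => e; rewrite !ffunE addbK.
have trP o f : f != f0 -> face_parity (tr o) f = face_parity o f (+) (b f (+) c f).
  move=> ff0; rewrite !face_parityE -(xE _ ff0).
  rewrite (@face_sum_eq _ _ _ (tr o) (fun e => o e - x e)) => [|e]; last by rewrite !ffunE.
  by rewrite face_sumB addrAC.
have bf0 : b f0 = false by apply/eqP; rewrite -TE.
rewrite sum1dep_card -(card_imset _ (inv_inj trK)) /mu; apply: eq_card => o.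
rewrite !inE -{1}(trK o) (mem_imset _ _ (inv_inj trK)) !inE.
apply/eqP/'forall_implyP => [/ffunP H f|H].
  rewrite !inE => ff0; have := H f; rewrite !ffunE ff0 /= trP //.
  rewrite /c ffunE ff0 -/(face_parity o f).
  by case: (face_parity o f); case: (b f).
apply/ffunP => f; rewrite ffunE; have [->|ff0] := eqVneq f f0; first by rewrite bf0.
have := H f; rewrite !inE ff0 -/(face_parity o f) /= trP // => ->//.
by rewrite /c ffunE ff0; case: (b f).
Qed.

End Count.

(** * Euler's formula from the cochain complex *)

Section Euler.
Context {R : realType} {S : set 'rV[R]_3} {K : cells R}.
Hypothesis hK : is_cellulated_surface S K.
Variables (src tgt : edge K -> vertex K) (v0 : vertex K) (f0 : face K).

Hypothesis closed_walks : forall (g : vertex K -> rat) f,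
  face_sum (fun e => g (tgt e) - g (src e)) f = 0.
Hypothesis exactness : forall c : edge K -> int, (forall f, face_sum c f = 0) ->
  exists g : vertex K -> int, forall e, c e = g (tgt e) - g (src e).
Hypothesis connectivity : forall g : vertex K -> bool,
  (forall e, g (tgt e) = g (src e)) -> forall u v, g u = g v.

Lemma dim_ffun (I : finType) : \dim {:{ffun I -> rat^o}} = #|I|.
Proof. by rewrite dimvf /dim /= muln1. Qed.

Lemma common_denominator (I : finType) (x : I -> rat) :
  exists d (y : I -> int), d != 0 /\ forall i, x i * d%:Q = (y i)%:Q.
Proof.
exists (\prod_i denq (x i)), (fun i => numq (x i) * \prod_(j | j != i) denq (x j)).
split=> [|i]; first by apply/prodf_neq0 => i _; exact: denq_neq0.
rewrite (bigD1 i)//= !intrM mulrA; congr (_ * _).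
by rewrite -{1}[x i]divq_num_den divfK // intr_eq0 denq_neq0.
Qed.

Let d0_fun (g : {ffun vertex K -> rat^o}) : {ffun edge K -> rat^o} :=
  [ffun e => g (tgt e) - g (src e)].
Let d1_fun (x : {ffun edge K -> rat^o}) : {ffun face K -> rat^o} :=
  [ffun f => face_sum x f].

Fact d0_linear : linear d0_fun.
Proof.
move=> a x y; apply/ffunP => e; rewrite !ffunE.
by rewrite scalerBr opprD addrACA.
Qed.
HB.instance Definition _ := GRing.isLinear.Build _ _ _ _ d0_fun d0_linear.

Fact d1_linear : linear d1_fun.
Proof.
move=> a x y; apply/ffunP => f; rewrite !ffunE /face_sum scaler_sumr -big_split /=.
apply: eq_bigr => s _; rewrite !ffunE.
by case: s.2; rewrite // opprD scalerN.
Qed.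
HB.instance Definition _ := GRing.isLinear.Build _ _ _ _ d1_fun d1_linear.

Let d0 := linfun d0_fun.
Let d1 := linfun d1_fun.

(** Connectedness is assumed for boolean functions only; applied to the
    indicator of a level set of [g] it shows that [g] is constant. *)
Lemma dim_ker_d0 : \dim (lker d0) = 1%N.
Proof.
pose one : {ffun vertex K -> rat^o} := [ffun=> 1].
suff -> : lker d0 = <[one]>%VS.
  rewrite dim_vline; case: eqP => // /ffunP/(_ v0); rewrite !ffunE => /eqP.
  by rewrite oner_eq0.
apply/eqP; rewrite eqEsubv; apply/andP; split; last first.
  rewrite -memvE memv_ker; apply/eqP/ffunP => e.
  by rewrite lfunE !ffunE /= subrr.
apply/subvP => g; rewrite memv_ker lfunE => /eqP/ffunP g0.
apply/vlineP; exists (g v0); apply/ffunP => v; rewrite !ffunE [RHS]mulr1.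
apply/eqP; have /(_ _ v v0) := connectivity (g := fun u => g u == g v0).
rewrite eqxx; apply=> e; have := g0 e.
by rewrite !ffunE => /eqP; rewrite subr_eq0 => /eqP ->.
Qed.

(** Exactness over the integers gives exactness over the rationals by clearing
    denominators. *)
Lemma ker_d1 : lker d1 = limg d0.
Proof.
apply/eqP; rewrite eqEsubv; apply/andP; split; apply/subvP => x.
  rewrite memv_ker lfunE => /eqP/ffunP x0.
  have [d [y [d_neq0 yE]]] := common_denominator x.
  have dQ : d%:Q != 0 by rewrite intr_eq0.
  have [f|g gE] := exactness (c := y).
    apply: (@intr_inj rat); rewrite -face_sum_morph.
    rewrite (@face_sum_eq _ _ _ _ (fun e => x e * d%:Q)) => [|e]; last by rewrite yE.
    rewrite (face_sum_morph (GRing.mulr_fun d%:Q idfun)).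
    by have := x0 f; rewrite !ffunE => ->; rewrite /= mul0r.
  suff -> : x = d0 [ffun v => (g v)%:Q / d%:Q] by rewrite memv_img ?memvf.
  apply/ffunP => e; rewrite lfunE !ffunE -mulrBl -intrB -gE -yE.
  by rewrite mulfK.
case/memv_imgP => g _ ->; rewrite memv_ker !lfunE; apply/eqP/ffunP => f.
rewrite !ffunE -[RHS](closed_walks g f).
by apply: face_sum_eq => e; rewrite ffunE.
Qed.

(** The image of [d1] is a complement of the line spanned by the cochain
    [delta f0]: it has total sum 0, and it contains all [delta f - delta f0]. *)
Lemma dim_img_d1 : (\dim (limg d1)).+1 = #|face K|.
Proof.
pose delta f : {ffun face K -> rat^o} := [ffun g => if g == f then 1 else 0].
have total : (limg d1 :&: <[delta f0]> = 0)%VS.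
  apply/eqP; rewrite -subv0; apply/subvP => y; rewrite memv_cap.
  case/andP => /memv_imgP[x _ ->] /vlineP[a]; rewrite lfunE => xa.
  have := total_face_sum hK x; rewrite memv0 xa.
  have /= : \sum_f d1_fun x f = a.
    rewrite xa (bigD1 f0)//= !ffunE eqxx big1 => [|f /negPf ff0].
      by rewrite addr0 [LHS]mulr1.
    by rewrite !ffunE ff0 [LHS]mulr0.
  under eq_bigr do rewrite ffunE.
  by move=> -> ->; rewrite scale0r.
have full : (limg d1 + <[delta f0]>)%VS = fullv.
  apply/eqP; rewrite eqEsubv subvf; apply/subvP => y _.
  have -> : y = \sum_f y f *: delta f.
    apply/ffunP => f; rewrite sum_ffunE (bigD1 f)//= !ffunE eqxx big1.
      by rewrite addr0 [RHS]mulr1.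
    by move=> g /negPf; rewrite eq_sym !ffunE => ->; rewrite [LHS]mulr0.
  apply: memv_suml => f _; apply: memvZ.
  have [x xE] := delta_boundary hK (1 : rat) f0 f.
  apply/memv_addP; exists (d1 (finfun x)); first by rewrite memv_img ?memvf.
  exists (delta f0); first exact: memv_line.
  apply/ffunP => g; rewrite lfunE !ffunE.
  rewrite (@face_sum_eq _ _ _ _ x) => [|e]; last by rewrite ffunE.
  by rewrite xE subrK.
have := dimv_disjoint_sum total; rewrite full dim_ffun dim_vline.
suff -> : delta f0 != 0 by rewrite addn1.
by apply/eqP => /ffunP/(_ f0); rewrite !ffunE eqxx => /eqP; rewrite oner_eq0.
Qed.

Lemma Euler_formula : (#|edge K| + 2 = #|vertex K| + #|face K|)%N.
Proof.
have := limg_ker_dim d0 fullv; have := limg_ker_dim d1 fullv.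
rewrite !capfv ker_d1 !dim_ffun dim_ker_d0 -dim_img_d1 => <- <-.
by rewrite addn2 add1n addnS.
Qed.

End Euler.

(** * Gluing and discreteness of continuous functions *)

Section Topology.
Local Open Scope classical_set_scope.

Lemma within_comp (T U W : topologicalType) (A : set T) (B : set U)
    (f : T -> U) (g : U -> W) :
  {within A, continuous f} -> {within B, continuous g} ->
  (forall x, A x -> B (f x)) -> {within A, continuous (g \o f)}.
Proof.
move=> /subspace_continuousP cf /subspace_continuousP cg fAB.
apply/subspace_continuousP => x Ax V /(cg _ (fAB _ Ax)) V'.
have H : \forall y \near x, A y -> B (f y) -> V (g (f y)) := cf x Ax _ V'.
suff : \forall y \near x, A y -> V (g (f y)) by [].
by near=> y => Ay; apply: (near H y) => //; exact: fAB.
Unshelve. all: by end_near. Qed.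

Lemma within_eq (T U : topologicalType) (A : set T) (f g : T -> U) :
  (forall x, A x -> g x = f x) -> {within A, continuous f} -> {within A, continuous g}.
Proof.
move=> fg; apply: subspace_eq_continuous => x /set_mem Ax.
by rewrite /from_subspace /= fg.
Qed.

(** A finite union of continuous images of compact sets in a Hausdorff space
    carries the quotient topology, so continuity can be tested on the pieces.
    By compactness it suffices to look near each [t] in [D i]: either [q i t] is
    [x], and [F \o q i] is continuous there, or points near [q i t] are not
    near [x]. *)
Lemma within_gluing (I : finType) (T X Y : topologicalType) (D : I -> set T)
    (q : I -> T -> X) (F : X -> Y) :
  hausdorff_space X -> (forall i, compact (D i)) ->
  (forall i, {within D i, continuous (q i)}) ->
  (forall i, {within D i, continuous (F \o q i)}) ->
  {within \bigcup_i (q i @` D i), continuous F}.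
Proof.
move=> hX cD cq cFq; apply/subspace_continuousP => x _ V FxV.
suff : \forall y \near x, forall i t, D i t -> q i t = y -> V (F y).
  move=> H; suff : \forall y \near x, (\bigcup_i (q i @` D i)) y -> V (F y) by [].
  by apply: filterS H => y H [i _ [t Dt qt]]; exact: H qt.
apply: filter_forall => i.
suff : \forall y \near x, D i `<=` [set t | D i t -> q i t = y -> V (F y)].
  by apply: filterS => y H t Dt; exact: H.
have /compact_near_coveringP := cD i.
apply=> t Dt; have [qx|qx] := pselect (q i t = x).
  rewrite -qx in FxV.
  have /subspace_continuousP/(_ t Dt _ FxV) Vt := cFq i.
  exists ([set t' | D i t' -> V (F (q i t'))], setT).
    by split=> //; exact: filterT.
  by move=> [t' y] /= [H _] Dt' <-; exact: H.
have : x != q i t by apply/eqP => /esym.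
move: hX; rewrite open_hausdorff => /[apply] -[[A B] /= [xA tB] [oA oB AB]].
have tB' : nbhs (q i t) B by apply: open_nbhs_nbhs; split=> //; exact/set_mem.
have xA' : nbhs x A by apply: open_nbhs_nbhs; split=> //; exact/set_mem.
have /subspace_continuousP/(_ t Dt _ tB') Bt := cq i.
exists ([set t' | D i t' -> B (q i t')], A); first by split.
move=> [t' y] /= [H Ay] Dt' qy.
have : (A `&` B) y by split=> //; rewrite -qy; exact: H.
by move/eqP: AB => ->.
Unshelve. all: by end_near. Qed.

Lemma int_valued_constant (R : realType) (f : R -> R) :
  {within `[0, 1], continuous f} ->
  (forall t, 0 <= t <= 1 -> f t \is a Num.int) -> f 0 = f 1.
Proof.
move=> cf fint.
have /intrP[m fm] : f 0 \is a Num.int by rewrite fint ?lexx ?ler01.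
have /intrP[n fn] : f 1 \is a Num.int by rewrite fint ?lexx ?ler01.
rewrite fm fn; congr (_%:~R); apply: contrapT => mn.
(* otherwise the function takes a half-integer value *)
have [t t01 ft] : exists2 t, t \in `[0, 1]%R & f t = (Num.min m n)%:~R + 2^-1.
  apply: IVT => //; rewrite fm fn.
  have [mn'|mn'|//] := ltgtP m n.
    have mnR : m%:~R <= n%:~R :> R by rewrite ler_int ltW.
    have : (m + 1)%:~R <= n%:~R :> R by rewrite ler_int lezD1.
    rewrite (min_l mnR) (max_r mnR) intrD; lra.
  have nmR : n%:~R <= m%:~R :> R by rewrite ler_int ltW.
  have : (n + 1)%:~R <= m%:~R :> R by rewrite ler_int lezD1.
  rewrite (min_r nmR) (max_l nmR) intrD; lra.
have /fint : 0 <= t <= 1 by move: t01; rewrite in_itv.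
rewrite ft => /intrP[k]; set l := Num.min m n => lk.
have : (k%:~R - l%:~R) * 2 = 1 :> R by rewrite -lk; lra.
rewrite -intrB -[2]/(2%:~R) -[1]/(1%:~R) -intrM => /intr_inj; lia.
Qed.

End Topology.

(** * The circle and polar coordinates in the disc *)

Section Circle.
Local Open Scope classical_set_scope.
Context {R : realType}.
Implicit Types (x y t : R) (u w : 'rV[R]_2).

Lemma circle_pt0E t : circle_pt t ord0 ord0 = cos (pi *+ 2 * t).
Proof. by rewrite mxE. Qed.

Lemma circle_pt1E t : circle_pt t ord0 ord_max = sin (pi *+ 2 * t).
Proof. by rewrite mxE. Qed.

Lemma sqnorm_scale n (a : R) (x : 'rV[R]_n) : sqnorm (a *: x) = a ^+ 2 * sqnorm x.
Proof. by rewrite /sqnorm mulr_sumr; apply: eq_bigr => i _; rewrite mxE exprMn. Qed.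

Lemma sqnorm_ge0 n (x : 'rV[R]_n) : 0 <= sqnorm x.
Proof. by apply: sumr_ge0 => i _; exact: sqr_ge0. Qed.

Lemma sqnorm_eq0 n (x : 'rV[R]_n) : sqnorm x = 0 -> x = 0.
Proof.
move/eqP; rewrite psumr_eq0 => [/allP x0|i _]; last exact: sqr_ge0.
apply/rowP => i; have := x0 i; rewrite mem_index_enum mxE sqrf_eq0 => /(_ isT).
by move/eqP.
Qed.

Lemma sqnorm2 u : sqnorm u = u ord0 ord0 ^+ 2 + u ord0 ord_max ^+ 2.
Proof.
rewrite /sqnorm !big_ord_recr /= big_ord0 add0r.
by congr (u _ _ ^+ 2 + u _ _ ^+ 2); apply: val_inj.
Qed.

Lemma row2P u w : u ord0 ord0 = w ord0 ord0 -> u ord0 ord_max = w ord0 ord_max -> u = w.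
Proof.
move=> uw0 uw1; apply/rowP => i; case: (unliftP ord_max i) => [j|] ->//.
by rewrite (_ : lift ord_max j = ord0)//; apply: val_inj; rewrite /= ord1.
Qed.

Lemma sqnorm_circle t : sqnorm (circle_pt t) = 1.
Proof. by rewrite sqnorm2 circle_pt0E circle_pt1E cos2Dsin2. Qed.

Lemma circle_ptD1 t : circle_pt (t + 1) = circle_pt t.
Proof.
apply: row2P; rewrite ?circle_pt0E ?circle_pt1E mulrDr mulr1.
  exact: cosD2pi.
exact: sinD2pi.
Qed.

Lemma circle_ptDz t (m : int) : circle_pt (t + m%:~R) = circle_pt t.
Proof.
have circleDn (n : nat) s : circle_pt (s + n%:R) = circle_pt s :> 'rV[R]_2.
  by elim: n => [|n IHn]; rewrite ?addr0// -natr1 addrA circle_ptD1.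
case: m => n; first exact: circleDn.
by rewrite -[LHS](circleDn n.+1) NegzE mulrNz subrK.
Qed.

Lemma circle_pt_eq x y : circle_pt x = circle_pt y <-> x - y \is a Num.int.
Proof.
split=> [xy|/intrP[m xy]]; last by rewrite -(circle_ptDz y m) -xy addrC subrK.
have cosxy : cos (pi *+ 2 * (x - y)) = 1.
  have /rowP xyE := xy; rewrite mulrBr cosB -!circle_pt0E -!circle_pt1E -!xyE.
  by rewrite -!expr2 -sqnorm2 sqnorm_circle.
set z := x - y in cosxy *; pose w := z - (Num.floor z)%:~R.
have zw : z = w + (Num.floor z)%:~R by rewrite subrK.
have w_ge0 : 0 <= w by rewrite subr_ge0 floor_le.
have w_lt1 : w < 1 by rewrite ltrBlDl; have := floorD1_gt z; rewrite intrD.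
have pi0 := pi_gt0 R.
have cosw : cos (pi *+ 2 * w) = 1.
  by rewrite -circle_pt0E -(circle_ptDz w (Num.floor z)) -zw circle_pt0E.
(* the cosine is injective on a half turn; w or 1 - w lies in it *)
have cos_eq1 (a : R) : 0 <= a <= 1 / 2 -> cos (pi *+ 2 * a) = 1 -> a = 0.
  move=> a01; have aI : pi *+ 2 * a \in `[0, pi]%R by rewrite in_itv /= mulr2n; nra.
  have zI : (0 : R) \in `[0, pi]%R by rewrite in_itv /= lexx pi_ge0.
  rewrite -cos0 => /(cos_inj aI zI)/eqP.
  by rewrite mulf_eq0 mulrn_eq0 /= gt_eqF//= => /eqP.
suff w0 : w = 0 by rewrite zw w0 add0r intr_int.
have [w2|w2] := leP w (1 / 2); first by apply: cos_eq1; rewrite ?w_ge0.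
suff : 1 - w = 0 by lra.
apply: cos_eq1; first by lra.
by rewrite mulrBr mulr1 cosB cos2pi sin2pi mul1r mul0r addr0.
Qed.

Lemma circle_pt_surj u : sqnorm u = 1 -> exists2 t, 0 <= t <= 1 & circle_pt t = u.
Proof.
rewrite sqnorm2 => u1; set a := u _ _ in u1; set b := u _ _ in u1.
have a11 : -1 <= a <= 1 by nra.
have pi0 := pi_gt0 R.
have [ac0 acpi] := (acos_ge0 a11, acos_lepi a11).
pose t := acos a / (pi *+ 2).
have tE : pi *+ 2 * t = acos a by rewrite mulrCA mulfV ?mulr1// mulrn_eq0/= gt_eqF.
have t01 : 0 <= t <= 1.
  by rewrite /t mulr2n divr_ge0 ?ler_pdivrMr /=; lra.
have cost : cos (acos a) = a by rewrite acosK// in_itv.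
have sint : sin (acos a) = `|b|.
  rewrite sin_acos//; have -> : 1 - a ^+ 2 = b ^+ 2 by lra.
  exact: sqrtr_sqr.
have [b0|b0] := leP 0 b.
  exists t => //; apply: row2P; rewrite ?circle_pt0E ?circle_pt1E tE ?cost//.
  by rewrite sint ger0_norm.
exists (1 - t); first by lra.
apply: row2P; rewrite ?circle_pt0E ?circle_pt1E mulrBr mulr1 tE.
  by rewrite cosB cos2pi sin2pi cost mul1r mul0r addr0.
by rewrite sinB cos2pi sin2pi sint ltr0_norm// mul0r mul1r sub0r opprK.
Qed.

Lemma row2_continuous (T : topologicalType) (a b : T -> R) :
  continuous a -> continuous b ->
  continuous (fun p => \row_(i < 2) (if i == ord0 then a p else b p)).
Proof.
move=> ca cb.
have -> : (fun p => \row_(i < 2) (if i == ord0 then a p else b p)) =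
    (fun p => a p *: delta_mx ord0 ord0 + b p *: delta_mx ord0 ord_max).
  apply/funext => p; apply: row2P; rewrite !mxE /=; ring.
move=> p; apply: cvgD; apply: cvgZ; by [exact: ca|exact: cb|exact: cvg_cst].
Qed.

End Circle.

Section Polar.
Local Open Scope classical_set_scope.
Context {R : realType}.
Implicit Types (x y t : R) (u w : 'rV[R]_2).

Lemma circle_pt_continuous : continuous (@circle_pt R).
Proof.
apply: row2_continuous => t; apply: continuous_comp;
  by [exact: mulrl_continuous|exact: continuous_cos|exact: continuous_sin].
Qed.

Definition square : set (R * R) := `[0, 1] `*` `[0, 1].

Lemma square_compact : compact square.
Proof. by apply: compact_setX; exact: segment_compact. Qed.

Lemma squareP r t : square (r, t) <-> (0 <= r <= 1) /\ (0 <= t <= 1).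
Proof. by rewrite /square /= !in_itv. Qed.

Definition polar (p : R * R) : 'rV[R]_2 := p.1 *: circle_pt p.2.

Lemma polar_continuous : continuous polar.
Proof.
move=> p; apply: cvgZ; first exact: cvg_fst.
by apply: continuous_comp; [exact: cvg_snd|exact: circle_pt_continuous].
Qed.

Lemma sqnorm_polar r t : sqnorm (polar (r, t)) = r ^+ 2.
Proof. by rewrite sqnorm_scale sqnorm_circle mulr1. Qed.

Lemma polar_surj u : closed_disc u -> exists r t, square (r, t) /\ polar (r, t) = u.
Proof.
rewrite /closed_disc /= => u1; have u0 := sqnorm_ge0 u.
have [un0|un0] := eqVneq (sqnorm u) 0.
  exists 0, 0; split; first by rewrite squareP !lexx ler01.
  by rewrite /polar scale0r (sqnorm_eq0 un0).
pose r := Num.sqrt (sqnorm u); have r2 : r ^+ 2 = sqnorm u by rewrite sqr_sqrtr.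
have r0 : r != 0 by rewrite -sqrf_eq0 r2.
have [|t t01 tu] := @circle_pt_surj R (r^-1 *: u).
  by rewrite sqnorm_scale exprVn r2 mulVf.
exists r, t; split; last by rewrite /polar tu scalerA divff// scale1r.
by rewrite squareP sqrtr_ge0 -[leRHS]sqrtr1 ler_wsqrtr.
Qed.

(** Polar coordinates are unique except on the seam, where [L 0 = L 1] makes
    the value well defined, and at the centre, where the value is 0. *)
Lemma cone_extension (L : R -> R) : L 0 = L 1 ->
  exists h : 'rV[R]_2 -> R, forall r t, square (r, t) -> h (polar (r, t)) = r * L t.
Proof.
move=> L01.
exists (fun u => xget 0 [set z | exists r t, [/\ square (r, t), polar (r, t) = u & z = r * L t]]).
move=> r t sq; case: xgetP => [z _ [r' [t' [sq' pp ->]]]|/(_ (r * L t))[]]; last first.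
  by exists r, t.
have /squareP[/andP[r0 r1] /andP[t0 t1]] := sq.
have /squareP[/andP[r0' r1'] /andP[t0' t1']] := sq'.
have rr : r' = r.
  by have /eqP := congr1 (@sqnorm R 2) pp; rewrite !sqnorm_polar eqrXn2// => /eqP.
rewrite rr; have [->|rn0] := eqVneq r 0; first by rewrite !mul0r.
congr (_ * _); move: pp; rewrite rr /polar /= => /(scalerI rn0)/circle_pt_eq/intrP[m tm].
have m_le1 : m%:~R <= 1%:~R :> R by lra.
have m_geN1 : (-1)%:~R <= m%:~R :> R by rewrite mulrNz; lra.
rewrite !ler_int in m_le1 m_geN1.
have [m0|[m0|m0]] : m = 0 \/ m = 1 \/ m = -1 by lia.
- by move/eqP: tm; rewrite m0 subr_eq0 => /eqP ->.
- have [-> ->] : t' = 1 /\ t = 0 by move: tm; rewrite m0 /=; lra.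
  by [].
- have [-> ->] : t' = 0 /\ t = 1 by move: tm; rewrite m0 mulrNz /=; lra.
  by [].
Qed.

Definition cdot u w := u ord0 ord0 * w ord0 ord0 + u ord0 ord_max * w ord0 ord_max.
Definition cross u w := u ord0 ord_max * w ord0 ord0 - u ord0 ord0 * w ord0 ord_max.
(** The number of turns from [w] to [u], for unit vectors less than a quarter
    turn apart. *)
Definition turn u w : R := asin (cross u w) / (pi *+ 2).

Lemma cdot_circle x y : cdot (circle_pt x) (circle_pt y) = cos (pi *+ 2 * (x - y)).
Proof. by rewrite /cdot !circle_pt0E !circle_pt1E mulrBr cosB. Qed.

Lemma cross_circle x y : cross (circle_pt x) (circle_pt y) = sin (pi *+ 2 * (x - y)).
Proof. by rewrite /cross !circle_pt0E !circle_pt1E mulrBr sinB. Qed.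

(** If the cosine of an angle is positive, the arcsine of its sine recovers the
    angle up to full turns. *)
Lemma turn_circle x y : 0 < cdot (circle_pt x) (circle_pt y) ->
  turn (circle_pt x) (circle_pt y) - (x - y) \is a Num.int.
Proof.
rewrite cdot_circle => c0; apply/circle_pt_eq; rewrite /turn cross_circle.
have pi0 := pi_gt0 R.
have s1 : -1 <= sin (pi *+ 2 * (x - y)) <= 1 by rewrite sin_geN1 sin_le1.
set a := asin _; have aE : pi *+ 2 * (a / (pi *+ 2)) = a.
  by rewrite mulrCA mulfV ?mulr1// mulrn_eq0/= gt_eqF.
apply: row2P; rewrite ?circle_pt0E ?circle_pt1E aE.
  by rewrite cos_asin// -cos2sin2 sqrtr_sqr gtr0_norm.
by rewrite asinK// in_itv.
Qed.

Lemma turn_continuous (T : topologicalType) (F G : T -> 'rV[R]_2) (p : T) :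
  {for p, continuous F} -> {for p, continuous G} ->
  sqnorm (F p) = 1 -> sqnorm (G p) = 1 -> 0 < cdot (F p) (G p) ->
  {for p, continuous (fun q => turn (F q) (G q))}.
Proof.
rewrite !sqnorm2 /cdot => cF cG; rewrite /continuous_at.
have cc (H : T -> 'rV[R]_2) i :
    {for p, continuous H} -> {for p, continuous (fun q => H q ord0 i)}.
  move=> cH; apply: (@continuous_comp _ _ _ H (fun u => u ord0 i)); first exact: cH.
  exact: coord_continuous.
move=> F1 G1 dot.
apply: cvgM; last exact: cvg_cst.
apply: (@continuous_comp _ _ _ (fun q => cross (F q) (G q)) asin).
  by apply: cvgB; apply: cvgM; exact: cc.
(* cdot ^ 2 + cross ^ 2 = 1, so |cross| < 1 *)
apply: continuous_asin; rewrite /cross; nra.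
Qed.

End Polar.

(** * Uniform subdivision of homotopies into the circle *)

Section Subdivision.
Local Open Scope classical_set_scope.
Context {R : realType}.

(** Uniform continuity on the square: for [N] large, a time step of at most
    [1 / (N + 1)] moves the value by less than a quarter turn.  For unit vectors
    this holds as soon as their distance is less than the square root of 2, hence
    as soon as both coordinates change by less than 1. *)
Lemma fine_subdivision (I : finType) (F : I -> R * R -> 'rV[R]_2) :
  (forall i, {within square, continuous (F i)}) ->
  (forall i p, square p -> sqnorm (F i p) = 1) ->
  exists N, forall i s t t', square (s, t) -> square (s, t') ->
    `|t - t'| <= N.+1%:R^-1 -> 0 < cdot (F i (s, t)) (F i (s, t')).
Proof.
move=> cF F1.
suff : \forall N \near \oo, forall i,
    square `<=` [set p | square p -> forall t', square (p.1, t') ->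
    `|p.2 - t'| <= N.+1%:R^-1 -> 0 < cdot (F i p) (F i (p.1, t'))].
  move=> [N _ /(_ N (leqnn N)) HN]; exists N => i s t t' st st' tt'.
  exact: (HN i (s, t) st st t' st' tt').
apply: filter_forall => i.
have /compact_near_coveringP := @square_compact R.
apply=> p0 sp0; pose u := F i p0.
have ub : nbhs u (ball u 2^-1) by apply: nbhsx_ballx; rewrite invr_gt0.
have /subspace_continuousP/(_ p0 sp0 _ ub) := cF i.
case/nbhs_ballP => e /= e0 He.
exists (ball p0 (e / 2), [set N | N.+1%:R^-1 < e / 2]).
  split; first by apply: nbhsx_ballx; rewrite divr_gt0.
  by apply: (near_infty_natSinv_lt (PosNum (divr_gt0 e0 (ltr0n R 2)))).
move=> [p N] /= [[ps pt] Ne] sp t' st' tt'.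
have [ps' pt'] : `|p0.1 - p.1| < e / 2 /\ `|p0.2 - p.2| < e / 2 by split.
have Hp : ball u 2^-1 (F i p).
  by apply: He => //; split; rewrite /ball /=; lra.
have Hq : ball u 2^-1 (F i (p.1, t')).
  apply: He => //; split; rewrite /ball /=; first by lra.
  rewrite -[p0.2](subrK p.2) -addrA (le_lt_trans (ler_normD _ _))//.
  by rewrite (lt_le_trans (ltrD pt' (le_lt_trans tt' Ne)))//; lra.
have coord v j : ball u 2^-1 v -> `|u ord0 j - v ord0 j| < 2^-1 by move=> [_ /(_ ord0 j)].
have := F1 i _ sp; have := F1 i _ st'; rewrite !sqnorm2 /cdot.
have := coord _ ord0 Hp; have := coord _ ord0 Hq.
have := coord _ ord_max Hp; have := coord _ ord_max Hq.
rewrite !ltr_norml.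
set a := F i p _ _; set b := F i p _ _; set c := F i (p.1, t') _ _; set d := F i (p.1, t') _ _.
move=> /andP[h1 h2] /andP[h3 h4] /andP[h5 h6] /andP[h7 h8] h9 h10.
have : (a - c) ^+ 2 < 1 by nra.
have : (b - d) ^+ 2 < 1 by nra.
nra.
Qed.

End Subdivision.

(** * Contracting the punctured sphere *)

Section Contraction.
Local Open Scope classical_set_scope.
Context {R : realType}.

Lemma sqnorm_continuous n : continuous (@sqnorm R n).
Proof.
apply: continuous_big => [|i _ x]; first exact: add_continuous.
apply: (@continuous_comp _ _ _ (fun y : 'rV[R]_n => y ord0 i) (fun z => z ^+ 2)).
  exact: coord_continuous.
exact: exprn_continuous.
Qed.

(** On the round sphere, with [P] the point to be removed, project radially the
    segment from [- P] to [x].  It avoids the origin, as [x] is not [P]. *)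
Lemma punctured_sphere_contraction (S : set 'rV[R]_3) (p : 'rV[R]_3) :
  is_2sphere S -> S p ->
  exists (x0 : 'rV[R]_3) (gamma : 'rV[R]_3 * R -> 'rV[R]_3),
   [/\ forall q, ((S `\ p) `*` `[0, 1]) q -> S (gamma q),
       forall x, (S `\ p) x -> gamma (x, 0) = x0,
       forall x, (S `\ p) x -> gamma (x, 1) = x &
       {within (S `\ p) `*` `[0, 1], continuous gamma}].
Proof.
move=> [h [k [ch ck hS kS kK]]] Sp.
have kU x : S x -> sqnorm (k x) = 1 by move=> Sx; have : (k @` S) (k x) by [exists x]; rewrite kS.
have hkK x : S x -> h (k x) = x.
  by rewrite -hS => -[y Uy <-]; rewrite kK.
pose P := k p; have P1 : sqnorm P = 1 by exact: kU.
pose line (q : 'rV[R]_3 * R) : 'rV[R]_3 := (1 - q.2) *: - P + q.2 *: k q.1.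
pose normalize (y : 'rV[R]_3) := (Num.sqrt (sqnorm y))^-1 *: y.
have line_neq0 q : ((S `\ p) `*` `[0, 1]) q -> line q <> 0.
  case: q => x t [/= [Sx xp] t01]; rewrite /line /= => /eqP.
  rewrite scalerN addrC subr_eq0 => /eqP tx.
  have := congr1 (@sqnorm R 3) tx; rewrite !sqnorm_scale P1 kU// !mulr1 => t2.
  (* x and P have norm 1, so the two coefficients agree *)
  have t12 : t = 1 - t by nra.
  have t0 : t != 0 by apply/eqP; lra.
  by apply: xp; rewrite /= -(hkK x)// -(hkK p)//; congr h; apply: (scalerI t0); rewrite tx -t12.
have normU y : y <> 0 -> sqnorm (normalize y) = 1.
  move=> y0; rewrite sqnorm_scale exprVn sqr_sqrtr ?sqnorm_ge0// mulVf//.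
  by apply/eqP => /sqnorm_eq0.
have unitK y : sqnorm y = 1 -> normalize y = y.
  by move=> y1; rewrite /normalize y1 sqrtr1 invr1 scale1r.
have sqN (y : 'rV[R]_3) : sqnorm (- y) = sqnorm y.
  by rewrite -scaleN1r sqnorm_scale sqrrN expr1n mul1r.
exists (h (- P)), (h \o (normalize \o line)); split.
- move=> q /line_neq0 q0; have : (h @` unit_sphere (n:=2)) (h (normalize (line q))).
    by exists (normalize (line q)) => //; exact: normU.
  by rewrite hS.
- move=> x _; rewrite /= /line /= subr0 scale1r scale0r addr0.
  by rewrite unitK// sqN.
- move=> x [Sx _]; rewrite /= /line /= subrr scale0r add0r scale1r unitK ?kU//.
  exact: hkK.
apply: (within_comp (B := unit_sphere (n:=2)) (f := normalize \o line) (g := h)) => //; last first.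
  by move=> q /line_neq0 q0; exact: normU.
pose B := [set y : 'rV[R]_3 | y <> 0].
apply: (within_comp (B := B) (f := line) (g := normalize)) => //; last first.
  apply/subspace_continuousP => y /= y0.
  apply: (@cvg_trans _ (normalize @ nbhs y)).
    by apply: cvg_app; exact: cvg_within.
  apply: cvgZ; last exact: cvg_id.
  apply: cvgV.
    by rewrite sqrtr_eq0 -ltNge lt_neqAle sqnorm_ge0 andbT eq_sym; apply/eqP => /sqnorm_eq0.
  apply: (@continuous_comp _ _ _ (@sqnorm R 3) Num.sqrt); first exact: sqnorm_continuous.
  exact: sqrt_continuous.
have ckx : {within (S `\ p) `*` `[0, 1], continuous (k \o (fst : 'rV[R]_3 * R -> 'rV[R]_3))}.
  apply: (within_comp (B := S) (f := fst) (g := k)) => //; last by move=> q [[]].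
  by apply: continuous_subspaceT => q; exact: cvg_fst.
have cs : {within (S `\ p) `*` `[0, 1], continuous (snd : 'rV[R]_3 * R -> R)}.
  by apply: continuous_subspaceT => q; exact: cvg_snd.
move=> q; apply: cvgD; apply: cvgZ.
- by apply: cvgB; [exact: cvg_cst|exact: cs].
- exact: cvg_cst.
- exact: cs.
- exact: ckx.
Qed.

End Contraction.

(** * Cells and boundary walks *)

Section Cells.
Local Open Scope classical_set_scope.
Context {R : realType} {S : set 'rV[R]_3} {K : cells R}.
Hypothesis hK : is_decomposition S K.
Implicit Types (e : edge K) (f : face K) (v : vertex K).

Local Notation cell := (vertex K + edge K + face K)%type.

Lemma open_cell_inj (c c' : cell) x :
  open_cell c x -> open_cell c' x -> c = c'.
Proof. by move=> cx cx'; apply: (cells_disjoint hK) => //; exists x. Qed.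

Lemma vpt_inj : injective (@vpt R K).
Proof.
move=> u v uv.
by have [] : inl (inl u) = inl (inl v) :> cell by apply: (@open_cell_inj _ _ (vpt u)).
Qed.

Lemma open_cell_sub (c : cell) x : open_cell c x -> S x.
Proof. by move=> cx; rewrite -(cells_cover hK); exists c. Qed.

(** The open cells partition S and are parametrised injectively, so a function
    on S may be prescribed cell by cell. *)
Lemma cellwise_function (T : choiceType) (z0 : T) (a : vertex K -> T) (b : edge K -> R -> T)
    (d : face K -> 'rV[R]_2 -> T) :
  exists H : 'rV[R]_3 -> T,
    [/\ forall v, H (vpt v) = a v,
        forall e t, 0 < t < 1 -> H (epar e t) = b e t &
        forall f x, open_disc x -> H (phi f x) = d f x].
Proof.
pose val (c : cell) (y : 'rV[R]_3) (z : T) : Prop :=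
  match c with
  | inl (inl v) => vpt v = y /\ z = a v
  | inl (inr e) => exists t, [/\ 0 < t < 1, epar e t = y & z = b e t]
  | inr f => exists x, [/\ open_disc x, phi f x = y & z = d f x]
  end.
have valE c y z : val c y z -> open_cell c y.
  case: c => [[v|e]|f] /= => [[<- _]//|[t [t01 <- _]]|[x [x1 <- _]]].
    by exists t => //=; rewrite in_itv.
  by exists x.
have val_fun c c' y z z' : val c y z -> val c' y z' -> z = z'.
  move=> cz cz'; have cc := open_cell_inj (valE _ _ _ cz) (valE _ _ _ cz').
  rewrite -{c'}cc in cz'; case: c cz cz' => [[v|e]|f] /=.
  - by move=> [_ ->] [_ ->].
  - by move=> [t [t01 ty ->]] [t' [t01' ty' ->]];
    rewrite (epar_inj hK t01 t01' (etrans ty (esym ty'))).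
  - by move=> [x [x1 xy ->]] [x' [x1' xy' ->]];
    rewrite (phi_inj hK x1 x1' (etrans xy (esym xy'))).
exists (fun y => xget z0 [set z | exists c, val c y z]).
have get c y z : val c y z -> xget z0 [set z | exists c, val c y z] = z.
  move=> cz; apply: xget_unique; first by exists c.
  by move=> z' [c' cz']; exact: val_fun cz' cz.
split=> [v|e t t01|f x x1].
- exact: (get (inl (inl v))).
- by apply: (get (inl (inr e))); exists t.
- by apply: (get (inr f)); exists x.
Qed.

Lemma polar_disc p : square p -> closed_disc (polar p : 'rV[R]_2).
Proof.
by case: p => r t /squareP[r01 t01]; rewrite /closed_disc /= sqnorm_polar; nra.
Qed.

Lemma polar_open r t : 0 <= r < 1 -> open_disc (polar (r, t) : 'rV[R]_2).
Proof. by move=> r01; rewrite /open_disc /= sqnorm_polar; nra. Qed.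

(** S is glued from the closed edges and faces.  All pieces are parametrised by
    the unit square, the faces in polar coordinates, so that on the boundary of
    a face the second coordinate runs along its sides. *)
Lemma cell_continuous (Y : topologicalType) (F : 'rV[R]_3 -> Y) :
  (forall e, {within `[0, 1], continuous (F \o epar e)}) ->
  (forall f, {within square, continuous (F \o (phi f \o polar))}) ->
  {within S, continuous F}.
Proof.
move=> cE cF.
pose D (c : cell) : set (R * R) := square.
pose q (c : cell) : R * R -> 'rV[R]_3 :=
  match c with
  | inl (inl v) => fun=> vpt v
  | inl (inr e) => epar e \o fst
  | inr f => phi f \o polar
  end.
have cfst : {within square, continuous (fst : R * R -> R)}.
  by apply: continuous_subspaceT => p; exact: cvg_fst.
have fst01 p : (square : set (R * R)) p -> `[0, 1] p.1 by case.
have cover : S `<=` \bigcup_c (q c @` D c).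
  rewrite -(cells_cover hK) => x [[[v|e]|f] _ /=].
  - move=> ->; exists (inl (inl v)) => //; exists (0, 0) => //.
    by apply/squareP; rewrite !lexx ler01.
  - move=> [t /=]; rewrite in_itv /= => /andP[t0 t1] tx.
    exists (inl (inr e)) => //; exists (t, 0) => //.
    by apply/squareP; rewrite lexx ler01 !ltW.
  - move=> [y y1 yx]; have [|r [t [sq ryt]]] := @polar_surj R y; first exact: ltW.
    by exists (inr f) => //; exists (r, t) => //=; rewrite ryt.
apply: (continuous_subspaceW cover); apply: within_gluing.
- exact: norm_hausdorff.
- by move=> c; exact: square_compact.
- case=> [[v|e]|f].
  + by apply: continuous_subspaceT => p; exact: cvg_cst.
  + exact: (within_comp cfst (@epar_cont _ _ _ hK e) fst01).
  + apply: (within_comp _ (@phi_cont _ _ _ hK f) polar_disc).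
    by apply: continuous_subspaceT; exact: polar_continuous.
- case=> [[v|e]|f].
  + by apply: continuous_subspaceT => p; exact: (@cvg_cst _ (F (vpt v))).
  + exact: (within_comp cfst (cE e) fst01).
  + exact: cF.
Qed.

Lemma epar_sub e t : 0 <= t <= 1 -> S (epar e t).
Proof.
move=> /andP[]; rewrite !le_eqVlt => /predU1P[<- _|t0 /predU1P[->|t1]].
- by have [[v _ <-] _] := epar_ends hK e; exact: (@open_cell_sub (inl (inl v))).
- by have [_ [v _ <-]] := epar_ends hK e; exact: (@open_cell_sub (inl (inl v))).
- by apply: (@open_cell_sub (inl (inr e))); exists t => //=; rewrite in_itv /= t0.
Qed.

Lemma face_center f : S (phi f 0) /\
  (forall v, vpt v <> phi f 0) /\ (forall e t, 0 <= t <= 1 -> epar e t <> phi f 0).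
Proof.
have pf : open_cell (inr f : cell) (phi f 0).
  exists 0 => //; rewrite /open_disc /=.
  by rewrite /sqnorm big1 ?ltr01// => i _; rewrite mxE expr0n.
have nv v : vpt v <> phi f 0.
  move=> vf; suff : inr f = inl (inl v) :> cell by [].
  by apply: open_cell_inj pf _ => /=.
split; [exact: open_cell_sub pf|split=> // e t].
move=> /andP[]; rewrite !le_eqVlt => /predU1P[<- _|t0 /predU1P[->|t1]].
- by have [[v _ <-] _] := epar_ends hK e.
- by have [_ [v _ <-]] := epar_ends hK e.
- move=> ef; suff : inr f = inl (inr e) :> cell by [].
  by apply: open_cell_inj pf _; rewrite -ef; exists t => //=; rewrite in_itv /= t0.
Qed.

Lemma edge_ends : exists src tgt : edge K -> vertex K,
  forall e, vpt (src e) = epar e 0 /\ vpt (tgt e) = epar e 1.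
Proof.
have /choice[src srcE] : forall e, exists v, vpt v = epar e 0.
  by move=> e; have [[v _ <-] _] := epar_ends hK e; exists v.
have /choice[tgt tgtE] : forall e, exists v, vpt v = epar e 1.
  by move=> e; have [_ [v _ <-]] := epar_ends hK e; exists v.
by exists src, tgt.
Qed.

(** At [t = 1] the point is the end of the last arc, [k = n - 1] and [s = 1]. *)
Lemma arc_decomposition n (t : R) : (0 < n)%N -> 0 <= t <= 1 ->
  exists k s, [/\ (k < n)%N, 0 <= s <= 1 & t = (k%:R + s) / n%:R].
Proof.
move=> n0 /andP[t0]; have nR : 0 < n%:R :> R by rewrite ltr0n.
rewrite le_eqVlt => /predU1P[->|t1].
  exists n.-1, 1; split; rewrite ?prednK ?ler01 ?lexx//.
  by rewrite natr1 prednK// divff// gt_eqF.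
have nt0 : 0 <= n%:R * t by rewrite mulr_ge0// ltW.
have /andP[kt tk] := truncn_itv nt0.
exists (Num.truncn (n%:R * t)), (n%:R * t - (Num.truncn (n%:R * t))%:R); split.
- by rewrite -(ltr_nat R) (le_lt_trans kt)// gtr_pMr.
- by move: kt tk; rewrite -natr1; lra.
- by rewrite addrC subrK mulrAC divff ?mul1r// gt_eqF.
Qed.

Lemma phi_side f s0 k t : (k < size (bdry f))%N -> 0 <= t <= 1 ->
  phi f (circle_pt ((k%:R + t) / (size (bdry f))%:R)) =
  epar (nth s0 (bdry f) k).1 (if (nth s0 (bdry f) k).2 then t else 1 - t).
Proof.
move=> kn t01; have := @side_par _ _ _ hK f k (nth s0 (bdry f) k).1 (nth s0 (bdry f) k).2 t.
by apply=> //; rewrite onthE (nth_map s0)//; case: nth.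
Qed.

Section Walks.
Variables (src tgt : edge K -> vertex K).
Hypothesis ends : forall e, vpt (src e) = epar e 0 /\ vpt (tgt e) = epar e 1.

Definition side_start (s : edge K * bool) := if s.2 then src s.1 else tgt s.1.
Definition side_finish (s : edge K * bool) := if s.2 then tgt s.1 else src s.1.

Lemma vpt_side_start f s0 k : (k < size (bdry f))%N ->
  vpt (side_start (nth s0 (bdry f) k)) = phi f (circle_pt (k%:R / (size (bdry f))%:R)).
Proof.
move=> kn; have := phi_side s0 kn (t := 0).
rewrite addr0 subr0 => ->; last by rewrite lexx ler01.
by rewrite /side_start; case: (nth s0 _ k) => e []; have [] := ends e.
Qed.

Lemma vpt_side_finish f s0 k : (k < size (bdry f))%N ->
  vpt (side_finish (nth s0 (bdry f) k)) = phi f (circle_pt (k.+1%:R / (size (bdry f))%:R)).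
Proof.
move=> kn; have := phi_side s0 kn (t := 1).
rewrite subrr natr1 => ->; last by rewrite lexx ler01.
by rewrite /side_finish; case: (nth s0 _ k) => e []; have [] := ends e.
Qed.

(** The corner between two consecutive sides is one point of the circle; the last
    and the first side meet at [circle_pt 1 = circle_pt 0]. *)
Lemma closed_walk f : cycle [rel s s' | side_finish s == side_start s'] (bdry f).
Proof.
have fin s0 := @vpt_side_finish f s0; have sta s0 := @vpt_side_start f s0.
have := bdry_pos hK f; case: (bdry f) fin sta => [//|x p] fin sta _.
apply/(pathP x) => i; rewrite size_rcons ltnS => ip /=.
apply/eqP/vpt_inj; rewrite -rcons_cons nth_rcons /= ltnS ip fin//.
rewrite nth_rcons; case: ltngtP ip => // [ip _|-> _].
  by rewrite -[nth x p i]/(nth x (x :: p) i.+1) sta.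
rewrite -[x in RHS]/(nth x (x :: p) 0) sta//= mul0r.
by rewrite divff ?pnatr_eq0// -[1]add0r circle_ptD1.
Qed.

Lemma closed_walk_invariant (T : Type) (g : vertex K -> T) f :
  (forall e, g (tgt e) = g (src e)) ->
  forall s s', s \in bdry f -> s' \in bdry f -> g (side_start s) = g (side_start s').
Proof.
move=> gE; have gS s : g (side_start s) = g (side_finish s).
  by rewrite /side_start /side_finish; case: s.2.
have := closed_walk f; case: (bdry f) => [//|x p] /=.
have walk y l : path [rel s s' | side_finish s == side_start s'] y l ->
    forall s, s \in l -> g (side_start s) = g (side_finish y).
  elim: l y => [//|z l IHl] y /= /andP[/eqP yz /IHl zl] s.
  by rewrite in_cons => /predU1P[->|/zl ->]; rewrite ?yz// -gS.
move=> /walk xp; have xp' s : s \in x :: p -> g (side_start s) = g (side_finish x).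
  by move=> sx; apply: xp; rewrite mem_rcons.
by move=> s s' /xp' -> /xp' ->.
Qed.

Lemma closed_walk_telescope (A : zmodType) (g : vertex K -> A) f :
  \sum_(s <- bdry f) (g (side_finish s) - g (side_start s)) = 0.
Proof.
have := closed_walk f; case: (bdry f) => [|x p]; first by rewrite big_nil.
have walk y l : path [rel s s' | side_finish s == side_start s'] y l ->
    \sum_(s <- l) (g (side_finish s) - g (side_start s)) =
    g (side_finish (last y l)) - g (side_finish y).
  elim: l y => [|z l IHl] y /=; first by rewrite big_nil subrr.
  by move=> /andP[/eqP yz /IHl zl]; rewrite big_cons zl yz addrC subrKA.
move=> /walk; rewrite last_rcons subrr; apply: etrans.
by apply: perm_big; rewrite perm_sym perm_rcons.
Qed.

End Walks.
End Cells.

(** * Connectedness and exactness from the contraction *)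

Section Cohomology.
Local Open Scope classical_set_scope.
Context {R : realType} {S : set 'rV[R]_3} {K : cells R}.
Hypothesis hK : is_decomposition S K.
Implicit Types (e : edge K) (f : face K) (v : vertex K).

(** The retraction of the line onto [0, 1], written with absolute values so that
    its continuity is immediate. *)
Definition ramp (x : R) : R := (`|x| - `|x - 1| + 1) / 2.

Lemma ramp_continuous : continuous ramp.
Proof.
move=> x; apply: cvgM; last exact: cvg_cst.
apply: cvgD; last exact: cvg_cst.
apply: cvgB; first exact: norm_continuous.
apply: (@continuous_comp _ _ _ (fun y : R => y - 1) Num.norm); last exact: norm_continuous.
by apply: cvgB; [exact: cvg_id|exact: cvg_cst].
Qed.

Lemma ramp_le0 x : x <= 0 -> ramp x = 0.
Proof. by move=> x0; rewrite /ramp !ler0_norm; lra. Qed.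

Lemma ramp_ge1 x : 1 <= x -> ramp x = 1.
Proof. by move=> x1; rewrite /ramp !ger0_norm; lra. Qed.

Lemma ramp01 x : 0 <= x <= 1 -> ramp x = x.
Proof. by move=> x01; rewrite /ramp ger0_norm ?ler0_norm; lra. Qed.

(** The total winding along the boundary of [f], as a function of the fraction of
    the boundary circle that has been traversed.  On each side it agrees modulo
    integers with the winding along the edge. *)
Lemma boundary_profile (c : edge K -> int) f : face_sum c f = 0 ->
  exists L : R -> R, [/\ continuous L, L 0 = L 1 &
    forall s0 k t, (k < size (bdry f))%N -> 0 <= t <= 1 ->
      L ((k%:R + t) / (size (bdry f))%:R) -
      (c (nth s0 (bdry f) k).1)%:~R * (if (nth s0 (bdry f) k).2 then t else 1 - t)
      \is a Num.int].
Proof.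
move=> c0; have := bdry_pos hK f; set n := size (bdry f) => n0.
have nR : n%:R != 0 :> R by rewrite pnatr_eq0 -lt0n.
have s1 : edge K * bool by move: n0; rewrite /n; case: (bdry f) => [//|s l _].
pose w k : int := let s := nth s1 (bdry f) k in if s.2 then c s.1 else - c s.1.
exists (fun x => \sum_(k < n) (w k)%:~R * ramp (n%:R * x - k%:R)); split.
- apply: continuous_big => [|k _ x]; first exact: add_continuous.
  apply: cvgM; first exact: cvg_cst.
  apply: (@continuous_comp _ _ _ (fun y : R => n%:R * y - k%:R) ramp); last exact: ramp_continuous.
  apply: cvgB; last exact: cvg_cst.
  by apply: cvgM; [exact: cvg_cst|exact: cvg_id].
- rewrite [LHS]big1 => [|k _]; last by rewrite ramp_le0 ?mulr0// sub0r oppr_le0.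
  have : \sum_(k < n) w k = 0.
    by apply: etrans c0; rewrite /face_sum (big_nth s1) big_mkord.
  move/(congr1 (fun z : int => z%:~R : R)); rewrite raddf_sum => w0.
  apply: (etrans (esym w0)); apply: eq_bigr => k _; rewrite mulr1 ramp_ge1 ?mulr1//.
  by rewrite lerBrDl natr1 ler_nat ltn_ord.
- move=> s0 k t kn t01; rewrite -/n mulrCA mulfV// mulr1.
  rewrite (set_nth_default s1)//.
  rewrite (bigD1 (Ordinal kn))//= addrAC addrC rpredD//.
    apply: rpred_sum => j jk; apply: rpredM; first exact: intr_int.
    have [jk'|jk'|jk'] := ltngtP j k.
    + rewrite ramp_ge1 ?rpred1//.
      have : j.+1%:R <= k%:R :> R by rewrite ler_nat.
      rewrite -natr1; lra.
    + rewrite ramp_le0 ?rpred0//.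
      have : k.+1%:R <= j%:R :> R by rewrite ler_nat.
      rewrite -natr1; lra.
    + by move: jk; rewrite -val_eqE /= jk' eqxx.
  rewrite [k%:R + t]addrC addrK ramp01// /w.
  case: (nth s1 (bdry f) k) => e [] /=; first by rewrite subrr rpred0.
  have -> : (- c e)%:~R * t - (c e)%:~R * (1 - t) = - (c e)%:~R :> R by rewrite mulrNz; ring.
  by rewrite rpredN intr_int.
Qed.

(** [H] is 0 at the vertices, linear on the open edges and a cone over
    [boundary_profile] on the open faces.  It jumps by integers where cells meet,
    so that [circle_pt \o H] is continuous. *)
Lemma circle_valued_map (c : edge K -> int) : (forall f, face_sum c f = 0) ->
  exists H : 'rV[R]_3 -> R,
    [/\ forall v, H (vpt v) = 0,
        forall e t, 0 <= t <= 1 ->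
          circle_pt (H (epar e t)) = circle_pt ((c e)%:~R * t) &
        {within S, continuous (@circle_pt R \o H)}].
Proof.
move=> c0; have [L LP] := choice (fun f => boundary_profile (c0 f)).
have /choice[h hP] : forall f, exists h : 'rV[R]_2 -> R,
    forall r t, square (r, t) -> h (polar (r, t)) = r * L f t.
  by move=> f; apply: cone_extension; have [] := LP f.
have [H [Hv He Hf]] := cellwise_function hK 0 (fun=> 0) (fun e t => (c e)%:~R * t) h.
have [src [tgt ends]] := edge_ends hK.
have circE e t : 0 <= t <= 1 -> circle_pt (H (epar e t)) = circle_pt ((c e)%:~R * t).
  have [se te] := ends e.
  move=> /andP[]; rewrite !le_eqVlt => /predU1P[<- _|t0 /predU1P[->|t1]].
  - by rewrite -se Hv mulr0.
  - by rewrite -te Hv mulr1; apply/circle_pt_eq; rewrite sub0r rpredN intr_int.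
  - by rewrite He// t0.
exists H; split=> //; apply: (cell_continuous hK) => [e|f].
  apply: (@within_eq _ _ _ (fun t : R => circle_pt ((c e)%:~R * t))) => [t t01|].
    by apply: circE; move: t01; rewrite /= in_itv.
  apply: continuous_subspaceT => t; apply: continuous_comp; last exact: circle_pt_continuous.
  exact: mulrl_continuous.
have [cL _ LE] := LP f.
apply: (@within_eq _ _ _ (fun p : R * R => circle_pt (p.1 * L f p.2))) => [[r t] sq|]; last first.
  apply: continuous_subspaceT => p.
  apply: (@continuous_comp _ _ _ (fun p : R * R => p.1 * L f p.2) (@circle_pt R));
    last exact: circle_pt_continuous.
  apply: cvgM; first exact: cvg_fst.
  by apply: continuous_comp; [exact: cvg_snd|exact: cL].
have /squareP[/andP[r0 r1] t01] := sq; rewrite /=.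
move: r1; rewrite le_eqVlt => /predU1P[r1|r1]; last first.
  by rewrite Hf ?hP//; apply: polar_open; rewrite r0.
have [k [s [kn s01 tE]]] := arc_decomposition (bdry_pos hK f) t01.
have [s0 _] : exists s0 : edge K * bool, True by case: (bdry f) kn => [//|s1]; exists s1.
rewrite /polar r1 /= scale1r mul1r tE (phi_side hK s0 kn s01) circE; last first.
  by case: ifP => // _; lra.
by apply/circle_pt_eq; rewrite -opprB rpredN LE.
Qed.

Hypothesis hS : is_2sphere S.
Variable f0 : face K.
Variables (src tgt : edge K -> vertex K).
Hypothesis ends : forall e, vpt (src e) = epar e 0 /\ vpt (tgt e) = epar e 1.

(** For [y] in the 1-skeleton, [lift y] adds up the small turns of the circle
    valued map along the track of [y] under the contraction.  It is continuous
    along each edge, and it agrees with [H y - H x0] modulo integers.  Hence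
    [lift (epar e s) + H x0 - c e * s] is continuous in [s] with integer values,
    so constant, and the numbers [lift (vpt v) + H x0] are the potential. *)
Lemma cocycle_exact (c : edge K -> int) : (forall f, face_sum c f = 0) ->
  exists g : vertex K -> int, forall e, c e = g (tgt e) - g (src e).
Proof.
move=> /circle_valued_map[H [Hv He cG]].
have [Sp [_ epar_p]] := face_center hK f0.
have [x0 [gamma [gS g0 g1 cg]]] := punctured_sphere_contraction hS Sp.
set p := phi f0 0 in Sp epar_p gS g0 g1 cg.
have SpE e t : 0 <= t <= 1 -> (S `\ p) (epar e t).
  by move=> t01; split; [exact: (epar_sub hK)|exact: epar_p].
pose E2 e (q : R * R) := (epar e q.1, q.2).
have cE2 e : {within square, continuous (E2 e)}.
  have cfst : {within square, continuous (epar e \o (fst : R * R -> R))}.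
    apply: (within_comp _ (@epar_cont _ _ _ hK e)); last by move=> q [].
    by apply: continuous_subspaceT => q; exact: cvg_fst.
  have csnd : {within square, continuous (snd : R * R -> R)}.
    by apply: continuous_subspaceT => q; exact: cvg_snd.
  by move=> q; exact: (cvg_pair (cfst q) (csnd q)).
have E2P e q : square q -> ((S `\ p) `*` `[0, 1]) (E2 e q).
  by move=> [/= q1 q2]; split=> //=; apply: SpE; move: q1; rewrite in_itv.
pose F e : R * R -> 'rV[R]_2 := (@circle_pt R \o H) \o (gamma \o E2 e).
have cF e : {within square, continuous (F e)}.
  apply: (@within_comp _ _ _ square S (gamma \o E2 e) (@circle_pt R \o H)) => [||q sq].
  - exact: (within_comp (cE2 e) cg (E2P e)).
  - exact: cG.
  - exact/gS/E2P.
have [|N HN] := fine_subdivision cF; first by move=> e q _; exact: sqnorm_circle.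
pose x j : R := j%:R / N.+1%:R.
have x01 j : (j <= N.+1)%N -> 0 <= x j <= 1.
  by move=> jN; rewrite divr_ge0//= ler_pdivrMr ?ltr0n// mul1r ler_nat.
pose lift (y : 'rV[R]_3) : R :=
  \sum_(j < N.+1) turn (circle_pt (H (gamma (y, x j.+1)))) (circle_pt (H (gamma (y, x j)))).
have dot e s (j : 'I_N.+1) : 0 <= s <= 1 ->
    0 < cdot (F e (s, x j.+1)) (F e (s, x j)).
  move=> s01; apply: HN.
  - by apply/squareP; split=> //; apply: x01.
  - by apply/squareP; split=> //; apply: x01; exact: ltnW.
  - by rewrite /x -natr1 mulrDl addrAC subrr add0r mul1r ger0_norm.
have liftE e s : 0 <= s <= 1 -> lift (epar e s) + H x0 - (c e)%:~R * s \is a Num.int.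
  move=> s01.
  have : lift (epar e s) - (H (epar e s) - H x0) \is a Num.int.
    have -> : H (epar e s) - H x0 =
        \sum_(j < N.+1) (H (gamma (epar e s, x j.+1)) - H (gamma (epar e s, x j))).
      rewrite -(big_mkord xpredT
        (fun j => H (gamma (epar e s, x j.+1)) - H (gamma (epar e s, x j)))).
      rewrite telescope_sumr// {1}/x divff ?pnatr_eq0// g1; last exact: SpE.
      by rewrite /x mul0r g0//; exact: SpE.
    rewrite -sumrB; apply: rpred_sum => j _; apply: turn_circle.
    exact: (dot e s j s01).
  have /circle_pt_eq := He e s s01 => /[swap] /rpredD/[apply].
  by congr (_ \is a Num.int); ring.
have lift_continuous e : {within `[0, 1], continuous (lift \o epar e)}.
  rewrite continuous_subspace_in => s; rewrite inE /= in_itv /= => s01.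
  have cj (j : nat) : (j <= N.+1)%N -> {within `[0, 1], continuous (fun s => F e (s, x j))}.
    move=> jN; apply: (within_comp _ (cF e)).
      by apply: continuous_subspaceT => r; exact: (cvg_pair cvg_id (cvg_cst (x j))).
    by move=> r; rewrite /= in_itv => r01; apply/squareP; split=> //; exact: x01.
  apply: cvg_big => [|j _]; first exact: add_continuous.
  have turnc := @turn_continuous R (subspace (`[0, 1] : set R)) (fun s => F e (s, x j.+1))
    (fun s => F e (s, x j)) s.
  apply: turnc.
  - exact: cj.
  - by apply: cj; exact: ltnW.
  - exact: sqnorm_circle.
  - exact: sqnorm_circle.
  - exact: dot.
(* the floor only casts to integers: by liftE the value at an end of an edge is one *)
exists (fun v => Num.floor (lift (vpt v) + H x0)) => e.
have [se te] := ends e.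
have := @int_valued_constant R (fun s => lift (epar e s) + H x0 - (c e)%:~R * s).
have -> : lift (vpt (src e)) + H x0 = lift (epar e 0) + H x0 - (c e)%:~R * 0.
  by rewrite se mulr0 subr0.
have -> : lift (vpt (tgt e)) + H x0 = (lift (epar e 1) + H x0 - (c e)%:~R * 1) + (c e)%:~R.
  by rewrite te mulr1 subrK.
move=> <- => [||t t01]; last exact: liftE.
  rewrite floorDrz ?intr_int// intrKfloor [X in X - _]addrC addrK//.
move=> s; apply: cvgB.
  by apply: cvgD; [exact: lift_continuous|exact: cvg_cst].
by apply: continuous_subspaceT => r; exact: mulrl_continuous.
Qed.

(** The boundary walk of a face sees a single value of [g], so [g] extends to a
    function that is constant on closed edges and faces, hence continuous on S.
    Being integer-valued it is constant along the track of each vertex, and all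
    tracks have the point [x0] in common. *)
Lemma vertices_connected (g : vertex K -> bool) :
  (forall e, g (tgt e) = g (src e)) -> forall u v, g u = g v.
Proof.
move=> gE.
have /choice[b bP] : forall f, exists b, forall s, s \in bdry f -> g (side_start src tgt s) = b.
  move=> f; have := closed_walk_invariant hK ends gE (f := f).
  case: (bdry f) (bdry_pos hK f) => [//|s l] _ H.
  by exists (g (side_start src tgt s)) => s' s'l; apply: H => //; rewrite mem_head.
have [H [Hv He Hf]] := cellwise_function hK (0 : R) (fun v => (g v)%:R)
  (fun e _ => (g (src e))%:R) (fun f _ => (b f)%:R).
have Hedge e t : 0 <= t <= 1 -> H (epar e t) = (g (src e))%:R.
  have [se te] := ends e.
  move=> /andP[]; rewrite !le_eqVlt => /predU1P[<- _|t0 /predU1P[->|t1]].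
  - by rewrite -se Hv.
  - by rewrite -te Hv gE.
  - by rewrite He// t0.
have cH : {within S, continuous H}.
  apply: (cell_continuous hK) => [e|f].
    apply: (@within_eq _ _ _ (fun _ : R => (g (src e))%:R : R)) => [t t01|].
      by apply: Hedge; move: t01; rewrite /= in_itv.
    by apply: continuous_subspaceT => t; exact: cvg_cst.
  apply: (@within_eq _ _ _ (fun _ : R * R => (b f)%:R : R)) => [[r t] sq|]; last first.
    by apply: continuous_subspaceT => t; exact: cvg_cst.
  have /squareP[/andP[r0 r1] t01] := sq; rewrite /=.
  move: r1; rewrite le_eqVlt => /predU1P[r1|r1]; last first.
    by rewrite Hf//; apply: polar_open; rewrite r0.
  have [k [s [kn s01 tE]]] := arc_decomposition (bdry_pos hK f) t01.
  have [s0 _] : exists s0 : edge K * bool, True by case: (bdry f) kn => [//|s1]; exists s1.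
  rewrite /polar r1 /= scale1r tE (phi_side hK s0 kn s01) Hedge; last first.
    by case: ifP => // _; lra.
  rewrite -(bP f (nth s0 (bdry f) k)) ?mem_nth//.
  by rewrite /side_start; case: (nth s0 (bdry f) k).2; rewrite ?gE.
have Hint y : S y -> H y \is a Num.int.
  rewrite -(cells_cover hK) => -[[[v|e]|f] _ /=].
  - by move=> ->; rewrite Hv natr_int.
  - by move=> [t]; rewrite /= in_itv /= => t01 <-; rewrite He// natr_int.
  - by move=> [y' y1 <-]; rewrite Hf// natr_int.
have [Sp [vp _]] := face_center hK f0.
have [x0 [gamma [gS g0 g1 cg]]] := punctured_sphere_contraction hS Sp.
set p := phi f0 0 in Sp vp gS g0 g1 cg.
have SpV v : (S `\ p) (vpt v).
  by split; [exact: (open_cell_sub hK (c := inl (inl v)))|exact: vp].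
suff all v : H x0 = (g v)%:R.
  move=> u v; have := all u; rewrite (all v).
  by case: (g u) (g v) => -[]//= /eqP; rewrite ?oner_eq0 // eq_sym oner_eq0.
rewrite -(Hv v) -(g0 _ (SpV v)) -[in RHS](g1 _ (SpV v)).
apply: (@int_valued_constant R (fun t => H (gamma (vpt v, t)))).
  have := @within_comp R ('rV[R]_3 * R)%type R `[0, 1] ((S `\ p) `*` `[0, 1])
    (fun t : R => (vpt v, t)) (H \o gamma).
  apply.
  - by apply: continuous_subspaceT => t; exact: (cvg_pair (cvg_cst (vpt v)) cvg_id).
  - exact: (within_comp cg cH).
  - by move=> t t01; split=> //; exact: SpV.
by move=> t t01; apply/Hint/gS; split=> /=; [exact: SpV|rewrite in_itv].
Qed.

End Cohomology.

Theorem corollary1 (R : realType) (S : set 'rV[R]_3) (K : cells R)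
    (hS : is_2sphere S) (hK : is_cellulated_surface S K) (f0 : face K) :
  #|[set o : {ffun edge K -> bool} | pfaffian (punctured_faces f0) o]%SET|
    = (2 ^ (#|vertex K| - 1))%N.
Proof.
have hD := decomposition hK.
have [src [tgt ends]] := edge_ends hD.
have v0 : vertex K.
  by have := bdry_pos hD f0; case: (bdry f0) => [//|[e b] l _]; exact: (src e).
have closed_walks (g : vertex K -> rat) f : face_sum (fun e => g (tgt e) - g (src e)) f = 0.
  rewrite -(closed_walk_telescope hD ends g f); apply: eq_bigr => s _.
  by rewrite /side_start /side_finish; case: s.2; rewrite ?opprB.
have Euler := Euler_formula hK v0 f0 closed_walks (cocycle_exact hD hS f0 ends)
  (vertices_connected hD hS f0 ends).
have V0 : (0 < #|vertex K|)%N by apply/card_gt0P; exists v0.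
have F0 : (0 < #|face K|)%N by apply/card_gt0P; exists f0.
have := card_pfaffian hK f0.
have -> : #|edge K| = ((#|face K| - 1) + (#|vertex K| - 1))%N by lia.
rewrite expnD => /eqP; rewrite eqn_pmul2l ?expn_gt0// => /eqP.
by move=> <-.
Qed.
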